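(* Let $\Gamma$ be a (possibly infinite) alphabet and let $S \subseteq \Gamma^*\times\Gamma^*$ be a confluent, weakly-terminating semi-Thue system such that the quotient monoid $G=\Gamma^*/S$ is a group. Let $\widehat S$ be the semi-Thue system obtained from $S$ by adding the prefix, suffix and infix rules (defined in the context, with respect to a fixed choice of words $\widetilde a$, $a\in\Gamma$, with $a\widetilde a=1$ in $G$). Then: 1) Words $u,v\in\Gamma^*$ are conjugate in $G$ if and only if there is a (cyclic) word $t$ such that $u \overset{\circledast}{\Longrightarrow}_{\widehat S} t \overset{\circledast}{\Longleftarrow}_{\widehat S} v$. 2) The rewriting relation $\overset{\circ}{\Longrightarrow}_{\widehat S}$ is confluent on cyclic words.
   Context: A semi-Thue system is a set $S\subseteq\Gamma^*\times\Gamma^*$; its one-step relation is $u\Rightarrow_S v$ iff $u=p\ell q$, $v=prq$ for some $(\ell,r)\in S$. $\Rightarrow_S^{*}$ is the reflexive transitive closure; $\Gamma^*/S$ is the quotient of $\Gamma^*$ by the congruence generated by $S$. The empty word is denoted $1$. A relation $\Rightarrow$ on a set is confluent if $y\Leftarrow^* x\Rightarrow^* z$ implies $y\Rightarrow^* w\Leftarrow^* z$ for some $w$; $S$ is confluent if $\Rightarrow_S$ is. Cyclic words: $u\sim v$ means $u=rs$, $v=sr$ for some $r,s\in\Gamma^*$; the cyclic word of $w$ is its class $w_\sim$ under $\sim$. For a semi-Thue system $T$, $u_\sim\overset{\circ}{\Longrightarrow}_T v_\sim$ iff there are $u'\sim u$, $v'\sim v$ with $u'\Rightarrow_T v'$;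 $\overset{\circledast}{\Longrightarrow}_T$ is the reflexive transitive closure of this relation on cyclic words and $\overset{\circledast}{\Longleftarrow}_T$ its converse. One writes $u$ in place of $u_\sim$. Weak termination: for $x,y\in\Gamma^*$ write $x>y$ if $x\Rightarrow_S^* pyq$ for some $p,q\in\Gamma^*$ with $pq\ne 1$. $S$ is weakly-terminating if there are no infinite chains $x_1>x_2>x_3>\cdots$. The words $\widetilde u$: for each $a\in\Gamma$ fix a word $\widetilde a\in\Gamma^*$ with $a\widetilde a=1$ in $G$; put $\widetilde 1=1$ and $\widetilde{va}=\widetilde a\,\widetilde v$ for $v\in\Gamma^*$, $a\in\Gamma$. The system $\widehat S$ consists of the following rules $u\to u'$: (original) $(u,u')\in S$; (prefix) $u=qv$, $u'=\widetilde p\,r\,v$, whenever $(pq,r)\in S$ with $p\neq1\neq q$; (suffix) $u=vp$, $u'=v\,r\,\widetilde q$, whenever $(pq,r)\in S$ with $p\neq1\neq q$; (infix) $u'=\widetilde p\,r\,\widetilde q$, whenever $(puq,r)\in S$ with $p\neq1\neq q$. *)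

(* Defs.v *)
From HB Require Import structures.
From Stdlib Require Export Relation_Operators.
From mathcomp Require Export all_boot.
From mathcomp Require Export boolp.

Set Implicit Arguments.
Unset Strict Implicit.
Unset Printing Implicit Defensive.

Local Open Scope quotient_scope.
Local Open Scope group_scope.

(* The alphabet is an arbitrary type; a semi-Thue system is an arbitrary
   (possibly infinite) set of rules, given as a binary relation on words. *)
Definition semi_thue (Gamma : Type) := seq Gamma -> seq Gamma -> Prop.

Inductive step (Gamma : Type) (S : semi_thue Gamma) : seq Gamma -> seq Gamma -> Prop :=
| Step p l r q : S l r -> step S (p ++ l ++ q) (p ++ r ++ q).

Definition steps (Gamma : Type) (S : semi_thue Gamma) :=
  clos_refl_trans (seq Gamma) (step S).

Definition confluent_rel (X : Type) (R : X -> X -> Prop) : Prop :=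
  forall x y z, clos_refl_trans X R x y -> clos_refl_trans X R x z ->
  exists w, clos_refl_trans X R y w /\ clos_refl_trans X R z w.

Definition confluent (Gamma : Type) (S : semi_thue Gamma) : Prop :=
  confluent_rel (step S).

Definition weak_gt (Gamma : Type) (S : semi_thue Gamma) (x y : seq Gamma) : Prop :=
  exists p q, steps S x (p ++ y ++ q) /\ p ++ q <> [::].

Definition weakly_terminating (Gamma : Type) (S : semi_thue Gamma) : Prop :=
  ~ exists x : nat -> seq Gamma, forall n, weak_gt S (x n) (x n.+1).

Inductive thue_cong (Gamma : Type) (S : semi_thue Gamma) : seq Gamma -> seq Gamma -> Prop :=
| ThueRule l r : S l r -> thue_cong S l r
| ThueRefl u : thue_cong S u u
| ThueSym u v : thue_cong S u v -> thue_cong S v u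
| ThueTrans u v w : thue_cong S u v -> thue_cong S v w -> thue_cong S u w
| ThueCat u u' v v' :
    thue_cong S u u' -> thue_cong S v v' -> thue_cong S (u ++ v) (u' ++ v').

(* [{classic T}] endows T with a choiceType structure via classical choice, which
   lets [{eq_quot _}] be used without any assumption on the alphabet. *)
Definition thue_congb (Gamma : Type) (S : semi_thue Gamma) :
  rel {classic seq Gamma} := fun u v => `[< thue_cong S u v >].

Lemma thue_congb_refl (Gamma : Type) (S : semi_thue Gamma) : reflexive (thue_congb S).
Proof. by move=> u; apply/asboolP; constructor. Qed.

Lemma thue_congb_sym (Gamma : Type) (S : semi_thue Gamma) : symmetric (thue_congb S).
Proof.
by move=> u v; apply/asboolP/asboolP => /ThueSym.
Qed.

Lemma thue_congb_trans (Gamma : Type) (S : semi_thue Gamma) : transitive (thue_congb S).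
Proof.
by move=> v u w /asboolP uv /asboolP vw; apply/asboolP; apply: ThueTrans uv vw.
Qed.

Definition thue_equiv (Gamma : Type) (S : semi_thue Gamma) :=
  EquivRel (thue_congb S) (@thue_congb_refl _ S) (@thue_congb_sym _ S)
    (@thue_congb_trans _ S).

(* The quotient monoid Gamma^* / S, with projection [word_class S]. *)
Definition thue_quot (Gamma : Type) (S : semi_thue Gamma) : Type :=
  {eq_quot (thue_equiv S)}.

HB.instance Definition _ (Gamma : Type) (S : semi_thue Gamma) :=
  Choice.copy (thue_quot S) {eq_quot (thue_equiv S)}.

Definition word_class (Gamma : Type) (S : semi_thue Gamma) (u : seq Gamma) : thue_quot S :=
  \pi_({eq_quot (thue_equiv S)}) (u : {classic seq Gamma}).

Definition word_repr (Gamma : Type) (S : semi_thue Gamma) (x : thue_quot S) : seq Gamma :=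
  repr (x : {eq_quot (thue_equiv S)}).

Lemma word_reprK (Gamma : Type) (S : semi_thue Gamma) (x : thue_quot S) :
  word_class S (word_repr x) = x.
Proof. exact: (@reprK _ {eq_quot (thue_equiv S)}). Qed.

Lemma word_classP (Gamma : Type) (S : semi_thue Gamma) (u v : seq Gamma) :
  word_class S u = word_class S v <-> thue_cong S u v.
Proof.
split=> [h|h].
  by apply/asboolP; move/(@eqmodP _ (thue_equiv S)): h.
by apply/(@eqmodP _ (thue_equiv S)); apply/asboolP.
Qed.

Definition thue_one (Gamma : Type) (S : semi_thue Gamma) : thue_quot S :=
  word_class S [::].

Definition thue_mul (Gamma : Type) (S : semi_thue Gamma) (x y : thue_quot S) : thue_quot S :=
  word_class S (word_repr x ++ word_repr y).

Lemma thue_mulE (Gamma : Type) (S : semi_thue Gamma) (u v : seq Gamma) :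
  thue_mul (word_class S u) (word_class S v) = word_class S (u ++ v).
Proof.
by apply/word_classP; apply: ThueCat; apply/word_classP; rewrite word_reprK.
Qed.

Lemma thue_mulA (Gamma : Type) (S : semi_thue Gamma) : associative (@thue_mul Gamma S).
Proof.
move=> x y z; rewrite -[x]word_reprK -[y]word_reprK -[z]word_reprK.
by rewrite !thue_mulE catA.
Qed.

Lemma thue_mul1 (Gamma : Type) (S : semi_thue Gamma) :
  left_id (thue_one S) (@thue_mul Gamma S).
Proof. by move=> x; rewrite -[x]word_reprK thue_mulE. Qed.

Lemma thue_mulr1 (Gamma : Type) (S : semi_thue Gamma) :
  right_id (thue_one S) (@thue_mul Gamma S).
Proof. by move=> x; rewrite -[x]word_reprK thue_mulE cats0. Qed.

HB.instance Definition _ (Gamma : Type) (S : semi_thue Gamma) :=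
  isMonoid.Build (thue_quot S)
    (@thue_mulA Gamma S) (@thue_mul1 Gamma S) (@thue_mulr1 Gamma S).

Lemma word_classM (Gamma : Type) (S : semi_thue Gamma) (u v : seq Gamma) :
  word_class S (u ++ v) = word_class S u * word_class S v.
Proof. by rewrite [RHS]thue_mulE. Qed.

Lemma word_class1 (Gamma : Type) (S : semi_thue Gamma) : word_class S [::] = 1.
Proof. by []. Qed.

Definition is_group (M : monoidType) : Prop :=
  forall x : M, exists y : M, x * y = 1 /\ y * x = 1.

(* Stated for a monoid, with z' the inverse of z; it is meant for a monoid that
   is a group. *)
Definition conjugate (M : monoidType) (x y : M) : Prop :=
  exists z z' : M, [/\ z * z' = 1, z' * z = 1 & y = z' * x * z].

Definition rotated (Gamma : Type) (u v : seq Gamma) : Prop :=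
  exists r s, u = r ++ s /\ v = s ++ r.

Lemma rotatedE (Gamma : Type) (u v : seq Gamma) :
  rotated u v <-> exists2 n, n <= size u & v = rot n u.
Proof.
split=> [[r [s [-> ->]]]|[n nu ->]].
  by exists (size r); rewrite ?size_cat ?leq_addr // rot_size_cat.
by exists (take n u), (drop n u); rewrite cat_take_drop.
Qed.

Definition rotatedb (Gamma : Type) : rel {classic seq Gamma} :=
  fun u v => `[< rotated u v >].

Lemma rotatedb_refl (Gamma : Type) : reflexive (@rotatedb Gamma).
Proof. by move=> u; apply/asboolP; exists [::], u; rewrite cats0. Qed.

Lemma rotatedb_sym (Gamma : Type) : symmetric (@rotatedb Gamma).
Proof. by move=> u v; apply/asboolP/asboolP=> -[r [s [-> ->]]]; exists s, r. Qed.

Lemma rotatedb_trans (Gamma : Type) : transitive (@rotatedb Gamma).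
Proof.
move=> v u w /asboolP/rotatedE[m mu ->] /asboolP/rotatedE[n nv ->].
rewrite size_rot in nv; apply/asboolP/rotatedE.
rewrite rot_add_mod //.
case: ifP => h; eexists; try reflexivity; first exact: h.
by rewrite leq_subLR leq_add.
Qed.

Definition rotated_equiv (Gamma : Type) :=
  EquivRel (@rotatedb Gamma) (@rotatedb_refl Gamma) (@rotatedb_sym Gamma)
    (@rotatedb_trans Gamma).

Definition cyclic_word (Gamma : Type) : Type := {eq_quot (rotated_equiv Gamma)}.

Definition cyc (Gamma : Type) (u : seq Gamma) : cyclic_word Gamma :=
  \pi_({eq_quot (rotated_equiv Gamma)}) (u : {classic seq Gamma}).

Lemma cycP (Gamma : Type) (u v : seq Gamma) : cyc u = cyc v <-> rotated u v.
Proof.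
split=> [h|h].
  by apply/asboolP; move/(@eqmodP _ (rotated_equiv Gamma)): h.
by apply/(@eqmodP _ (rotated_equiv Gamma)); apply/asboolP.
Qed.

Lemma cyc_surj (Gamma : Type) (c : cyclic_word Gamma) : exists u, c = cyc u.
Proof.
by exists (repr (c : {eq_quot (rotated_equiv Gamma)})); rewrite /cyc reprK.
Qed.

Definition cyc_step (Gamma : Type) (T : semi_thue Gamma) (c d : cyclic_word Gamma) : Prop :=
  exists u v, [/\ cyc u = c, cyc v = d & step T u v].

Definition cyc_steps (Gamma : Type) (T : semi_thue Gamma) :=
  clos_refl_trans (cyclic_word Gamma) (cyc_step T).

(* [inv a] is the chosen word for the letter a; see [tilde_rcons] for the defining
   recursion. *)
Definition tilde (Gamma : Type) (inv : Gamma -> seq Gamma) (u : seq Gamma) : seq Gamma :=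
  flatten [seq inv a | a <- rev u].

Lemma tilde_nil (Gamma : Type) (inv : Gamma -> seq Gamma) : tilde inv [::] = [::].
Proof. by []. Qed.

Lemma tilde_rcons (Gamma : Type) (inv : Gamma -> seq Gamma) v a :
  tilde inv (rcons v a) = inv a ++ tilde inv v.
Proof. by rewrite /tilde rev_rcons. Qed.

(* In [HatInfix] the word u may be empty; p and q may not. *)
Inductive hat (Gamma : Type) (inv : Gamma -> seq Gamma) (S : semi_thue Gamma) :
  seq Gamma -> seq Gamma -> Prop :=
| HatOriginal u u' : S u u' -> hat inv S u u'
| HatPrefix p q r v : S (p ++ q) r -> p <> [::] -> q <> [::] ->
    hat inv S (q ++ v) (tilde inv p ++ r ++ v)
| HatSuffix p q r v : S (p ++ q) r -> p <> [::] -> q <> [::] ->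
    hat inv S (v ++ p) (v ++ r ++ tilde inv q)
| HatInfix p u q r : S (p ++ u ++ q) r -> p <> [::] -> q <> [::] ->
    hat inv S u (tilde inv p ++ r ++ tilde inv q).

(* Main.v *)
Require Import Defs.
From Stdlib Require Import Operators_Properties.
From mathcomp Require Import all_boot.

(** Every rule of [hat inv S] is an identity in G and rotating a word conjugates
    its class, so cyclic rewriting stays inside a conjugacy class
    ([cyc_steps_conjugate]).  This is the easy half of the first claim; it also
    reduces the second claim to the first, because the two ends of a fork of
    cyclic derivations are conjugate.

    The substance is the converse, [conjugating_word_join]: if [u z = z v] in G,
    then the cyclic words of [u] and [v] have a common descendant.  The proof is
    an induction on the conjugating word [z] along the well-founded order
    [weak_gt].  By confluence [u ++ z] and [z ++ v] have a common descendant [t]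
    under [S].  Follow the derivation [u ++ z =>* t] ([steps_cat]).  Either it
    never crosses the boundary between [u] and [z], or some rule [p ++ q -> r]
    does, with [u =>* u1 ++ p] and [z =>* q ++ z1].  In the latter case the
    suffix rule rewrites [u] to [u1 ++ r ++ tilde q]; its rotation
    [tilde q ++ u1 ++ r] represents the conjugate of [u] by [q], and is
    conjugated to [v] by the smaller word [z1].  A crossing in [z ++ v =>* t] is
    absorbed likewise by the prefix rule.

    If nothing crosses on either side, then [t = u' ++ z' = z'' ++ v'], where
    [z'] and [z''] are descendants of [z].  Either [u' = z'' ++ d] and
    [v' = d ++ z'], which are rotations of each other up to joining [z'] with
    [z''], or [z'' = u' ++ z1] and [z' = z1 ++ v'], so that [z1] conjugates [u']
    to [v'] and is smaller than [z] unless [u'] is empty. *)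

Set Implicit Arguments.
Unset Strict Implicit.
Unset Printing Implicit Defensive.

Local Open Scope group_scope.

(** * Linear rewriting *)

Lemma step_ctx (Gamma : Type) (S : semi_thue Gamma) x y u v :
  step S u v -> step S (x ++ u ++ y) (x ++ v ++ y).
Proof.
case=> p l r q lr.
have ctxE w : x ++ (p ++ w ++ q) ++ y = (x ++ p) ++ w ++ (q ++ y) by rewrite !catA.
by rewrite !ctxE; exact: Step.
Qed.

Lemma steps_ctx (Gamma : Type) (S : semi_thue Gamma) x y u v :
  steps S u v -> steps S (x ++ u ++ y) (x ++ v ++ y).
Proof.
elim=> [a b ab|a|a b c _ ab _ bc]; first by apply: rt_step; exact: step_ctx.
  exact: rt_refl.
exact: rt_trans ab bc.
Qed.

Lemma steps_catl (Gamma : Type) (S : semi_thue Gamma) x u v :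
  steps S u v -> steps S (x ++ u) (x ++ v).
Proof. by move=> /(@steps_ctx _ _ x [::]); rewrite !cats0. Qed.

Lemma steps_catr (Gamma : Type) (S : semi_thue Gamma) y u v :
  steps S u v -> steps S (u ++ y) (v ++ y).
Proof. exact: (@steps_ctx _ _ [::] y). Qed.

Lemma step_rule (Gamma : Type) (S : semi_thue Gamma) l r : S l r -> step S l r.
Proof. by move=> /(@Step _ S [::] l r [::]); rewrite !cats0. Qed.

Lemma steps_cong (Gamma : Type) (S : semi_thue Gamma) u v :
  steps S u v -> thue_cong S u v.
Proof.
elim=> [a b [p l r q lr]|a|a b c _ ab _ bc].
- by do ![apply: ThueCat => //; try exact: ThueRefl]; exact: ThueRule.
- exact: ThueRefl.
- exact: ThueTrans ab bc.
Qed.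

Lemma church_rosser (Gamma : Type) (S : semi_thue Gamma) u v :
  confluent S -> thue_cong S u v -> exists2 w, steps S u w & steps S v w.
Proof.
move=> confS; elim=> {u v} [l r lr|u|u v _ [w uw vw]|u v w _ [a ua va] _ [b vb wb]|].
- by exists r; [apply: rt_step; exact: step_rule|exact: rt_refl].
- by exists u; exact: rt_refl.
- by exists w.
- have [c [ac bc]] := confS _ _ _ va vb.
  by exists c; [exact: rt_trans ua ac|exact: rt_trans wb bc].
- move=> u u' v v' _ [a ua ua'] _ [b vb vb'].
  exists (a ++ b).
    by apply: rt_trans (steps_catr _ ua) (steps_catl _ vb).
  by apply: rt_trans (steps_catr _ ua') (steps_catl _ vb').
Qed.

Lemma cat_eqP (T : Type) (a b c d : seq T) : a ++ b = c ++ d ->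
  (exists2 e, a = c ++ e & d = e ++ b) \/
  (exists2 e, c = a ++ e & b = e ++ d).
Proof.
elim: a c => [|x a IH] [|y c] /=.
- by move=> ->; left; exists [::].
- by move=> ->; right; exists (y :: c).
- by move=> <-; left; exists (x :: a).
- case=> -> /IH[[e -> ->]|[e -> ->]]; first by left; exists e.
  by right; exists e.
Qed.

(** Rewriting stays on the two sides of the cut until the first rule whose
    left-hand side straddles it; an empty left-hand side straddles nothing. *)
Lemma steps_cat (Gamma : Type) (S : semi_thue Gamma) u z t :
  steps S (u ++ z) t ->
  (exists u' z', [/\ t = u' ++ z', steps S u u' & steps S z z']) \/
  (exists u1 p q z1 r, [/\ steps S u (u1 ++ p), steps S z (q ++ z1),
     S (p ++ q) r, p <> [::] & q <> [::]]).
Proof.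
move=> /(@clos_rt_rtn1 _ (step S) _ _); elim=> [|y {}t yt _ [[u' [z' [yE uu' zz']]]|cross]].
- by left; exists u, z; split=> //; exact: rt_refl.
- case: yt yE => x l r w lr /esym /cat_eqP[[e u'E lwE]|[e xE z'E]].
  + move/cat_eqP: lwE => [[q lE z'E]|[w' eE wE]].
      case: q => [|c q] in lE z'E *.
        left; exists (x ++ r), w; split; first by rewrite catA.
        * apply: rt_trans uu' _; rewrite u'E; apply/steps_catl/rt_step/step_rule.
          by rewrite lE cats0 in lr.
        * by rewrite z'E in zz'.
      case: e => [|b e] in lE u'E *.
        left; exists x, (r ++ w); split=> //; first by rewrite u'E cats0 in uu'.
        apply: rt_trans zz' _; rewrite z'E; apply/steps_catr/rt_step/step_rule.
        by rewrite lE in lr.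
      right; exists x, (b :: e), (c :: q), w, r.
      by rewrite -u'E -z'E -lE; split.
    left; exists (x ++ r ++ w'), z'; split=> //; first by rewrite wE !catA.
    apply: rt_trans uu' _; rewrite u'E eE; apply/steps_catl/steps_catr/rt_step.
    exact: step_rule.
  + left; exists u', (e ++ r ++ w); split=> //; first by rewrite xE -catA.
    apply: rt_trans zz' _; rewrite z'E; apply/steps_catl/steps_catr/rt_step.
    exact: step_rule.
- by right.
Qed.

(** Dependent choice extracts an infinite chain from a non-accessible word. *)
Lemma weak_gt_wf (Gamma : Type) (S : semi_thue Gamma) :
  weakly_terminating S -> well_founded (fun y x => weak_gt S x y).
Proof.
move=> wt x0; apply: contrapT => nacc.
pose bad := {x | ~ Acc (fun y x => weak_gt S x y) x}.
have nxt (b : bad) : exists c : bad, weak_gt S (sval b) (sval c).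
  case: b => x nx /=; apply: contrapT => nex; apply: nx; constructor=> y xy.
  by apply: contrapT => ny; apply: nex; exists (exist _ y ny).
have [f fP] := choice nxt.
apply: wt; exists (fun n => sval (iter n f (exist _ x0 nacc))) => n.
exact: fP.
Qed.

(** * The words [tilde inv u] *)

Lemma tilde_cat (Gamma : Type) (inv : Gamma -> seq Gamma) u v :
  tilde inv (u ++ v) = tilde inv v ++ tilde inv u.
Proof. by rewrite /tilde rev_cat map_cat flatten_cat. Qed.

Lemma tilde_right (Gamma : Type) (S : semi_thue Gamma) inv u :
  (forall a : Gamma, word_class S [:: a] * word_class S (inv a) = 1) ->
  word_class S u * word_class S (tilde inv u) = 1.
Proof.
move=> invr; elim: u => [|a u IH]; first by rewrite mulg1.
have tilde1 : tilde inv [:: a] = inv a by rewrite /tilde /= cats0.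
rewrite -cat1s tilde_cat tilde1 !word_classM mulgA.
by rewrite -[_ * _ * word_class S (tilde _ _)]mulgA IH mulg1.
Qed.

Lemma tilde_left (Gamma : Type) (S : semi_thue Gamma) inv u :
  is_group (thue_quot S) ->
  (forall a : Gamma, word_class S [:: a] * word_class S (inv a) = 1) ->
  word_class S (tilde inv u) * word_class S u = 1.
Proof.
move=> grp invr; have [y [_ yu]] := grp (word_class S u).
suff -> : word_class S (tilde inv u) = y by [].
by rewrite -[LHS]mul1g -yu -mulgA tilde_right // mulg1.
Qed.

(** * Soundness of cyclic rewriting *)

Lemma conjugate_refl (M : monoidType) (x : M) : conjugate x x.
Proof. by exists 1, 1; rewrite !mulg1 mul1g. Qed.

Lemma conjugate_sym (M : monoidType) (x y : M) : conjugate x y -> conjugate y x.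
Proof.
case=> z [z' [zz' z'z ->]]; exists z', z; split=> //.
by rewrite !mulgA zz' mul1g -mulgA zz' mulg1.
Qed.

Lemma conjugate_trans (M : monoidType) (x y w : M) :
  conjugate x y -> conjugate y w -> conjugate x w.
Proof.
case=> a [a' [aa' a'a ->]] [b [b' [bb' b'b ->]]]; exists (a * b), (b' * a').
split; last by rewrite !mulgA.
- by rewrite mulgA -[a * b * b']mulgA bb' mulg1.
- by rewrite mulgA -[b' * a' * a]mulgA a'a mulg1.
Qed.

Lemma rotated_conjugate (Gamma : Type) (S : semi_thue Gamma) u v :
  is_group (thue_quot S) -> rotated u v ->
  conjugate (word_class S u) (word_class S v).
Proof.
move=> grp [r [s [-> ->]]]; have [y [ry yr]] := grp (word_class S r).
by exists (word_class S r), y; rewrite !word_classM !mulgA yr mul1g.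
Qed.

Lemma hat_cong (Gamma : Type) (S : semi_thue Gamma) inv u v :
  is_group (thue_quot S) ->
  (forall a : Gamma, word_class S [:: a] * word_class S (inv a) = 1) ->
  hat inv S u v -> thue_cong S u v.
Proof.
move=> grp invr; have rule l r : S l r -> word_class S r = word_class S l.
  by move=> lr; apply/esym/word_classP/ThueRule.
have tl p := @tilde_left _ S inv p grp invr.
have tr p := @tilde_right _ S inv p invr.
case=> {u v} [u v /ThueRule //|p q r v /rule rE _ _|p q r v /rule rE _ _
             |p u q r /rule rE _ _]; apply/word_classP;
  rewrite !word_classM {}rE !word_classM !mulgA ?tl ?mul1g //.
- by rewrite -[in RHS]mulgA tr mulg1.
- by rewrite -[in RHS]mulgA tr mulg1.
Qed.

Lemma cyc_steps_conjugate (Gamma : Type) (S : semi_thue Gamma) inv u v :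
  is_group (thue_quot S) ->
  (forall a : Gamma, word_class S [:: a] * word_class S (inv a) = 1) ->
  cyc_steps (hat inv S) (cyc u) (cyc v) ->
  conjugate (word_class S u) (word_class S v).
Proof.
move=> grp invr; move uE: (cyc u) => c; move vE: (cyc v) => d st.
elim: st u v uE vE => {c d} [_ _ [a [b [<- <- [p l r q lr]]]]|c|c x d _ IH1 _ IH2] u v.
- move=> /cycP /(rotated_conjugate grp) ua /esym/cycP /(rotated_conjugate grp) bv.
  apply: conjugate_trans ua (conjugate_trans _ bv).
  rewrite !word_classM.
  have /word_classP -> := hat_cong grp invr lr.
  exact: conjugate_refl.
- by move=> <- /esym/cycP; exact: rotated_conjugate.
- have [w wE] := cyc_surj x.
  by move=> uE vE; exact: conjugate_trans (IH1 _ _ uE (esym wE)) (IH2 _ _ (esym wE) vE).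
Qed.

(** * Conjugate words have a common cyclic descendant *)

Definition cyc_join (Gamma : Type) (T : semi_thue Gamma) (u v : seq Gamma) :=
  exists t, cyc_steps T (cyc u) t /\ cyc_steps T (cyc v) t.

Lemma cyc_rot (Gamma : Type) (u v : seq Gamma) : cyc (u ++ v) = cyc (v ++ u).
Proof. by apply/cycP; exists u, v. Qed.

Lemma steps_cyc (Gamma : Type) (T : semi_thue Gamma) u v :
  steps T u v -> cyc_steps T (cyc u) (cyc v).
Proof.
elim=> [a b ab|a|a b c _ ab _ bc]; [|exact: rt_refl|exact: rt_trans ab bc].
by apply: rt_step; exists a, b.
Qed.

Lemma steps_hat (Gamma : Type) (S : semi_thue Gamma) inv u v :
  steps S u v -> steps (hat inv S) u v.
Proof.
elim=> [_ _ [p l r q lr]|a|a b c _ ab _ bc]; [|exact: rt_refl|exact: rt_trans ab bc].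
by apply: rt_step; apply: Step; exact: HatOriginal.
Qed.

Lemma cyc_join_steps (Gamma : Type) (T : semi_thue Gamma) u u' v v' :
  cyc_steps T (cyc u) (cyc u') -> cyc_steps T (cyc v) (cyc v') ->
  cyc_join T u' v' -> cyc_join T u v.
Proof.
move=> uu' vv' [t [u't v't]].
by exists t; split; [exact: rt_trans uu' u't|exact: rt_trans vv' v't].
Qed.

(** The suffix rule, followed by a rotation, conjugates by [q]. *)
Lemma suffix_conjugates (Gamma : Type) (S : semi_thue Gamma) inv u u1 p q r :
  steps S u (u1 ++ p) -> S (p ++ q) r -> p <> [::] -> q <> [::] ->
  cyc_steps (hat inv S) (cyc u) (cyc (tilde inv q ++ u1 ++ r)).
Proof.
move=> uu1 pqr p0 q0; rewrite cyc_rot -catA; apply: steps_cyc.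
apply: rt_trans (steps_hat inv uu1) (rt_step _ _ _ _ _).
exact/step_rule/HatSuffix.
Qed.

Lemma prefix_conjugates (Gamma : Type) (S : semi_thue Gamma) inv v v1 p q r :
  steps S v (q ++ v1) -> S (p ++ q) r -> p <> [::] -> q <> [::] ->
  cyc_steps (hat inv S) (cyc v) (cyc (r ++ v1 ++ tilde inv p)).
Proof.
move=> vv1 pqr p0 q0; rewrite catA cyc_rot; apply: steps_cyc.
apply: rt_trans (steps_hat inv vv1) (rt_step _ _ _ _ _).
exact/step_rule/HatPrefix.
Qed.

Lemma conjugating_word_join (Gamma : Type) (S : semi_thue Gamma) inv z u v :
  confluent S -> weakly_terminating S -> is_group (thue_quot S) ->
  (forall a : Gamma, word_class S [:: a] * word_class S (inv a) = 1) ->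
  word_class S u * word_class S z = word_class S z * word_class S v ->
  cyc_join (hat inv S) u v.
Proof.
move=> confS wt grp invr; have tl p := @tilde_left _ S inv p grp invr.
have tr p := @tilde_right _ S inv p invr.
have stepsE x y : steps S x y -> word_class S x = word_class S y.
  by move=> xy; apply/word_classP; exact: steps_cong.
have ruleE l r : S l r -> word_class S r = word_class S l.
  by move=> lr; apply/esym/word_classP/ThueRule.
have liftc x y : steps S x y -> cyc_steps (hat inv S) (cyc x) (cyc y).
  by move=> xy; apply/steps_cyc/steps_hat.
elim/(well_founded_ind (weak_gt_wf wt)): z u v => z IH u v uz.
have /(church_rosser confS)[t uzt zvt] : thue_cong S (u ++ z) (z ++ v).
  by apply/word_classP; rewrite !word_classM.
have [[u' [z' [tE uu' zz']]]|] := steps_cat uzt; last first.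
  move=> [u1 [p [q [z1 [r [uu1 zz1 pqr p0 q0]]]]]].
  apply: cyc_join_steps (suffix_conjugates inv uu1 pqr p0 q0) (rt_refl _ _ _) _.
  apply: (IH z1); first by exists q, [::]; rewrite !cats0.
  move: uz; rewrite (stepsE _ _ uu1) (stepsE _ _ zz1) !word_classM (ruleE _ _ pqr).
  rewrite word_classM -!mulgA => ->.
  by rewrite mulgA tl mul1g.
have [[z'' [v' [tE' zz'' vv']]]|] := steps_cat zvt; last first.
  move=> [z1 [p [q [v1 [r [zz1 vv1 pqr p0 q0]]]]]].
  apply: cyc_join_steps (rt_refl _ _ _) (prefix_conjugates inv vv1 pqr p0 q0) _.
  apply: (IH z1); first by exists [::], p.
  move: uz; rewrite (stepsE _ _ zz1) (stepsE _ _ vv1) !word_classM (ruleE _ _ pqr).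
  rewrite word_classM !mulgA => <-.
  by rewrite -[RHS]mulgA tr mulg1.
have z'z'' : word_class S z' = word_class S z''.
  by rewrite -(stepsE _ _ zz') -(stepsE _ _ zz'').
apply: cyc_join_steps (liftc _ _ uu') (liftc _ _ vv') _.
move: tE; rewrite tE' => /esym /cat_eqP[[d u'E v'E]|[z1 z''E z'E]].
  have [w z'w z''w] : exists2 w, steps S z' w & steps S z'' w.
    by apply: church_rosser confS _; apply/word_classP.
  exists (cyc (w ++ d)); rewrite u'E v'E [cyc (d ++ _)]cyc_rot.
  by split; apply/liftc/steps_catr.
case: u' => [|a u'] in uu' z''E *.
  (* Here [u] is trivial in G, hence so is its conjugate [v], and linear
     confluence suffices; the induction hypothesis is not available as [z1] may
     be [z] itself. *)
  have [y [_ yz]] := grp (word_class S z).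
  have v1 : word_class S v' = word_class S [::].
    rewrite -(stepsE _ _ vv') -[LHS]mul1g -yz -mulgA -uz (stepsE _ _ uu').
    by rewrite word_class1 mul1g.
  have [w uw vw] : exists2 w, steps S [::] w & steps S v' w.
    by apply: church_rosser confS _; apply/word_classP.
  by exists (cyc w); split; exact: liftc.
apply: (IH z1).
  by exists (a :: u'), [::]; rewrite cats0 -z''E.
by rewrite -!word_classM -z''E -z'E.
Qed.

Theorem theorem2p3 (Gamma : Type) (S : semi_thue Gamma)
    (S_confluent : confluent S)
    (S_weakly_terminating : weakly_terminating S)
    (G_group : is_group (thue_quot S))
    (inv : Gamma -> seq Gamma)
    (inv_right : forall a : Gamma,
       (word_class S [:: a] * word_class S (inv a) = 1)%g) :
  (forall u v : seq Gamma,
     conjugate (word_class S u) (word_class S v) <->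
     exists t : cyclic_word Gamma,
       cyc_steps (hat inv S) (cyc u) t /\ cyc_steps (hat inv S) (cyc v) t) /\
  confluent_rel (cyc_step (hat inv S)).
Proof.
have join u v : conjugate (word_class S u) (word_class S v) ->
    cyc_join (hat inv S) u v.
  case=> x [y [xy _ vE]]; apply: (@conjugating_word_join _ _ _ (word_repr x)) => //.
  by rewrite word_reprK vE !mulgA xy mul1g.
split=> [u v|x y z].
  split=> [|[t]]; first exact: join.
  have [w ->] := cyc_surj t.
  move=> [/(cyc_steps_conjugate G_group inv_right) uw].
  move=> /(cyc_steps_conjugate G_group inv_right)/conjugate_sym.
  exact: conjugate_trans.
have [[a ->] [b ->]] := (cyc_surj x, cyc_surj y); have [c ->] := cyc_surj z.
move=> /(cyc_steps_conjugate G_group inv_right) ab.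
move=> /(cyc_steps_conjugate G_group inv_right) ac.
exact: join (conjugate_trans (conjugate_sym ab) ac).
Qed.
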